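(* Let $m,d,\tau,d_{\mathrm t},d_{\mathrm b}>0$. Consider the power network under the proportionality assumption with representative generator $\hat g_{\mathrm o}(s)=\frac{\tau s+1}{m\tau s^2+(m+d\tau)s+d+d_{\mathrm t}}$ and frequency shaping control $\hat c_{\mathrm o}(s)=\hat c_{\mathrm{fs}}(s)=\frac{d_{\mathrm t}}{\tau s+1}-(d_{\mathrm b}+d_{\mathrm t})$, subject to step power disturbances $\boldsymbol p=\boldsymbol u_0\mathds{1}_{t\ge0}$ with $\boldsymbol u_0=(u_{0,1},\dots,u_{0,n})\in\mathbb R^n$. Let $$\underline\alpha=\begin{cases}\dfrac{d+d_{\mathrm b}+d_{\mathrm t}}{2m} & \text{if } d_{\mathrm b}\le 2\sqrt{\lambda_2 m}-d-d_{\mathrm t},\\[2mm] \dfrac{d+d_{\mathrm b}+d_{\mathrm t}-\sqrt{(d+d_{\mathrm b}+d_{\mathrm t})^2-4\lambda_2 m}}{2m} & \text{otherwise.}\end{cases}$$ Then the frequency deviations $\boldsymbol\omega_{\mathrm{fs}}(t)=\bar\omega_{\mathrm{fs}}(t)\boldsymbol 1_n+\tilde{\boldsymbol\omega}_{\mathrm{fs}}(t)$ synchronize to the steady-state value $$\bar\omega_{\mathrm{fs}}(\infty)=\frac{\sum_{i=1}^n u_{0,i}}{(d+d_{\mathrm b}+d_{\mathrm t})\sum_{i=1}^n r_i}$$ exponentially fast with rate $\underline\alpha$, i.e., there is a constant $\delta>0$ such that for all $t\ge 0$ $$\|\boldsymbol\omega_{\mathrm{fs}}(t)-\bar\omega_{\mathrm{fs}}(\infty)\boldsymbol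 1_n\|<\delta e^{-\underline\alpha t}.$$ In particular: (i) the COI frequency deviation evolves as $$\bar\omega_{\mathrm{fs}}(t)=\bar\omega_{\mathrm{fs}}(\infty)\left(1-e^{-\frac{d+d_{\mathrm b}+d_{\mathrm t}}{m}t}\right),$$ which converges to $\bar\omega_{\mathrm{fs}}(\infty)$ exponentially fast with rate $(d+d_{\mathrm b}+d_{\mathrm t})/m>\underline\alpha$; (ii) the frequency oscillations $\tilde{\boldsymbol\omega}_{\mathrm{fs}}(t)$ decay exponentially fast to zero with a rate of at least $\underline\alpha$.
   Context: Power network model: $n\ge2$ buses, connected network; $\boldsymbol L_{\mathrm B}\in\mathbb R^{n\times n}$ is its undirected weighted Laplacian (symmetric, positive semidefinite, kernel spanned by the all-ones vector $\boldsymbol 1_n$). Proportionality assumption: there are $r_i>0$ such that bus $i$ has generator transfer function $\hat g_i=\hat g_{\mathrm o}/r_i$ and inverter transfer function $\hat c_i=r_i\hat c_{\mathrm o}$. With $\hat{\boldsymbol G}=\mathrm{diag}(\hat g_i)$, $\hat{\boldsymbol C}=\mathrm{diag}(\hat c_i)$, $\hat{\boldsymbol H}=(\boldsymbol I_n-\hat{\boldsymbol G}\hat{\boldsymbol C})^{-1}\hat{\boldsymbol G}$, the frequency deviations are given in the Laplace domain by $\hat{\boldsymbol\omega}(s)=(\boldsymbol I_n+\hat{\boldsymbol H}(s)\boldsymbol L_{\mathrm B}/s)^{-1}\hat{\boldsymbol H}(s)\hat{\boldsymbol p}(s)$; here $\hat{\boldsymbol p}(s)=\boldsymbol u_0/s$.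 $\mathds{1}_{t\ge 0}$ is the unit-step function. With $\boldsymbol R=\mathrm{diag}(r_1,\dots,r_n)$, $\boldsymbol L=\boldsymbol R^{-1/2}\boldsymbol L_{\mathrm B}\boldsymbol R^{-1/2}$ has eigenvalues $0=\lambda_1<\lambda_2\le\dots\le\lambda_n$ with orthonormal eigenvectors $\boldsymbol v_1=(\sum_i r_i)^{-1/2}\boldsymbol R^{1/2}\boldsymbol 1_n,\boldsymbol v_2,\dots,\boldsymbol v_n$. Put $\hat z_k(s)=\hat g_{\mathrm o}(s)/\left(1+\hat g_{\mathrm o}(s)(\lambda_k/s-\hat c_{\mathrm o}(s))\right)$ and let $z_{\mathrm u,k}(t)$ be the inverse Laplace transform of $\hat z_k(s)/s$ (unit-step response). Then $\boldsymbol\omega(t)=\bar\omega(t)\boldsymbol 1_n+\tilde{\boldsymbol\omega}(t)$ with $$\bar\omega(t)=\frac{\sum_i u_{0,i}}{\sum_i r_i}z_{\mathrm u,1}(t)\ \text{(the COI frequency deviation)},\qquad \tilde{\boldsymbol\omega}(t)=\sum_{k=2}^n z_{\mathrm u,k}(t)\boldsymbol R^{-1/2}\boldsymbol v_k\boldsymbol v_k^T\boldsymbol R^{-1/2}\boldsymbol u_0 .$$ The subscript ''fs'' indicates that $\hat c_{\mathrm o}=\hat c_{\mathrm{fs}}$. A signal decays exponentially to zero with rate at least $\alpha$ if its norm is bounded by $Ce^{-\alpha t}$ for all $t\ge0$, for some constant $C>0$.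
   Formalization: At critical damping, d+d_b+d_t = 2√(λ_2 m), the mode k=2 is t e^{-αt}/m and the bounds at rate α fail for general u_0; there the synchronization bound and (ii) are stated for every rate a < α instead of α itself. *)

(* Defs.v *)
From HB Require Import structures.
From mathcomp Require Import all_boot all_order all_algebra.
From mathcomp Require Import all_classical all_reals all_analysis.
From mathcomp Require Import complex.

Set Implicit Arguments.
Unset Strict Implicit.
Unset Printing Implicit Defensive.

Import Order.TTheory GRing.Theory Num.Theory.
Import numFieldNormedType.Exports.

Local Open Scope classical_set_scope.
Local Open Scope ring_scope.
Local Open Scope complex_scope.

(* Real and imaginary parts of the integral of e^(-st) f(t) over [0, +oo[. *)
Definition laplace (R : realType) (f : R -> R) (s : R[i]) : R[i] :=
  Complex
    (Rintegral lebesgue_measure `[0%R, +oo[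
       (fun t => expR (- (complex.Re s * t)) * cos (complex.Im s * t) * f t))
    (- Rintegral lebesgue_measure `[0%R, +oo[
       (fun t => expR (- (complex.Re s * t)) * sin (complex.Im s * t) * f t)).

(* A signal is pinned down by its transform only almost everywhere, and only
   on [0, +oo[: continuity on [0, +oo[ selects the usual representative, and
   values at negative times are irrelevant.  The transform is required to
   converge absolutely, and to agree with F, on some right half-plane. *)
Definition is_inverse_laplace (R : realType) (F : R[i] -> R[i]) (f : R -> R)
    : Prop :=
  {within `[0%R, +oo[, continuous f} /\
  exists sigma : R, forall s : R[i], sigma < complex.Re s ->
    (@lebesgue_measure R).-integrable `[0%R, +oo[
       (EFin \o (fun t : R => expR (- (complex.Re s * t)) * f t)) /\
    laplace f s = F s.

Definition inverse_laplace (R : realType) (F : R[i] -> R[i]) : R -> R :=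
  xget (fun=> 0) [set f | is_inverse_laplace F f].

(* Self-loops w i i play no role. *)
Definition laplacian (R : realType) (n : nat) (w : 'M[R]_n) : 'M[R]_n :=
  \matrix_(i, j) (if i == j then \sum_(k | k != i) w i k else - w i j).

Definition connected_network_laplacian (R : realType) (n : nat)
    (LB : 'M[R]_n) : Prop :=
  exists w : 'M[R]_n,
    [/\ forall i j, w i j = w j i,
        forall i j, 0 <= w i j,
        forall i j, connect [rel k l | 0 < w k l] i j
      & LB = laplacian w].

Definition complex_mx (R : realType) (m n : nat) (A : 'M[R]_(m, n)) :
    'M[R[i]]_(m, n) := \matrix_(i, j) (A i j)%:C.

Section Frequency.
Variables (R : realType) (n : nat).
Variables (LB : 'M[R]_n) (r : 'I_n -> R).
Variables (go co : R[i] -> R[i]).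

Definition gen_mx (s : R[i]) : 'M[R[i]]_n :=
  diag_mx (\row_i (go s / (r i)%:C)).

Definition inv_mx (s : R[i]) : 'M[R[i]]_n :=
  diag_mx (\row_i ((r i)%:C * co s)).

(* invmx and x^-1 are total; no singular case arises on 0 < Re s for the
   generator and controller below, hence none matters to inverse_laplace. *)
Definition closed_loop_mx (s : R[i]) : 'M[R[i]]_n :=
  invmx (1%:M - gen_mx s *m inv_mx s) *m gen_mx s.

(* The disturbance is the step u0 1_(t >= 0), of transform u0 / s. *)
Definition omega_hat (u0 : 'cV[R]_n) (s : R[i]) : 'cV[R[i]]_n :=
  invmx (1%:M + closed_loop_mx s *m (s^-1 *: complex_mx LB))
    *m closed_loop_mx s *m (s^-1 *: complex_mx u0).

Definition omega (u0 : 'cV[R]_n) (t : R) : 'cV[R]_n :=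
  \col_i inverse_laplace (fun s => omega_hat u0 s i 0) t.

Definition scale_mx : 'M[R]_n := diag_mx (\row_i Num.sqrt (r i)).

Definition scaleV_mx : 'M[R]_n := diag_mx (\row_i (Num.sqrt (r i))^-1).

Definition scaled_laplacian : 'M[R]_n := scaleV_mx *m LB *m scaleV_mx.

Definition z_hat (lambda : R) (s : R[i]) : R[i] :=
  go s / (1 + go s * (lambda%:C / s - co s)).

Definition z_step (lambda : R) : R -> R :=
  inverse_laplace (fun s => z_hat lambda s / s).

End Frequency.

(* Decomposition of the frequency deviation along an orthonormal eigenbasis of
   the scaled Laplacian; the k-th eigenvector is the k-th column of V. *)
Section Modes.
Variables (R : realType) (n : nat) (r : 'I_n.+1 -> R).
Variables (go co : R[i] -> R[i]).
Variables (lam : 'I_n.+1 -> R) (V : 'M[R]_n.+1) (u0 : 'cV[R]_n.+1).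

Definition omega_coi (t : R) : R :=
  (\sum_i u0 i 0) / (\sum_i r i) * z_step go co (lam ord0) t.

Definition omega_osc (t : R) : 'cV[R]_n.+1 :=
  \sum_(k | k != ord0) z_step go co (lam k) t *:
    (scaleV_mx r *m col k V *m (col k V)^T *m scaleV_mx r *m u0).

End Modes.

Definition ordered_eigenbasis (R : realType) (n : nat) (L : 'M[R]_n)
    (lam : 'I_n -> R) (V : 'M[R]_n) : Prop :=
  [/\ forall i j : 'I_n, (i <= j)%N -> lam i <= lam j,
      V^T *m V = 1%:M
    & forall k, L *m col k V = lam k *: col k V].

Definition generator_tf (R : realType) (m d tau dt : R) (s : R[i]) : R[i] :=
  (tau%:C * s + 1) /
  ((m * tau)%:C * s ^+ 2 + (m + d * tau)%:C * s + (d + dt)%:C).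

Definition fs_tf (R : realType) (tau dt db : R) (s : R[i]) : R[i] :=
  dt%:C / (tau%:C * s + 1) - (db + dt)%:C.

(* At equality in the test, the mode of eigenvalue lambda2 is critically damped,
   proportional to t e^(-alpha t) with alpha the value returned. *)
Definition sync_rate (R : realType) (m d dt db lambda2 : R) : R :=
  if db <= 2 * Num.sqrt (lambda2 * m) - d - dt
  then (d + db + dt) / (2 * m)
  else (d + db + dt - Num.sqrt ((d + db + dt) ^+ 2 - 4 * lambda2 * m))
         / (2 * m).

Definition norm2 (R : realType) (n : nat) (v : 'cV[R]_n) : R :=
  Num.sqrt (\sum_i v i 0 ^+ 2).

Definition decays_exponentially (R : realType) (n : nat)
    (x : R -> 'cV[R]_n) (alpha : R) : Prop :=
  exists2 C : R, 0 < C &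
    forall t, 0 <= t -> norm2 (x t) <= C * expR (- (alpha * t)).

Definition synchronizes_exponentially (R : realType) (n : nat)
    (x : R -> 'cV[R]_n) (xinf : 'cV[R]_n) (alpha : R) : Prop :=
  exists2 delta : R, 0 < delta &
    forall t, 0 <= t -> norm2 (x t - xinf) < delta * expR (- (alpha * t)).

(* Main.v *)
Require Import Defs.
From HB Require Import structures.
From mathcomp Require Import all_boot all_order all_algebra.
From mathcomp Require Import all_classical all_reals all_analysis.
From mathcomp Require Import complex.
From mathcomp Require Import measurable_realfun ring lra.

Set Implicit Arguments.
Unset Strict Implicit.
Unset Printing Implicit Defensive.

Import Order.TTheory GRing.Theory Num.Theory.
Import numFieldNormedType.Exports.

Local Open Scope classical_set_scope.
Local Open Scope ring_scope.
Local Open Scope complex_scope.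

(* In the eigenbasis of the scaled Laplacian the closed loop is diagonal, and
   the controller cancels the turbine: 1 / g_o(s) - c_o(s) = m s + D with
   D = d + db + dt.  Hence the k-th mode has transform
   z_k(s) / s = 1 / (m s^2 + D s + lambda_k), that of the impulse response of
   m z'' + D z' + lambda_k z = 0, which is
   e^(-a t) sinh (sqrt kappa t) / (m sqrt kappa) with a = D / (2 m) and
   kappa = a^2 - lambda_k / m (a sine if kappa < 0, and t if kappa = 0); its
   decay rate is a - sqrt (max kappa 0), which is least for lambda_2.  Lerch's
   uniqueness theorem identifies these functions with the chosen inverse
   transforms. *)

(** * Improper integrals *)

(** [inverse_laplace] is an unspecified choice, about which nothing is known before a concrete
    inverse transform has been exhibited and proved unique; not even linearity is immediate.
    Computations therefore run on the relation [is_inverse_laplace], and [inverse_laplaceE]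
    transfers the outcome to the chosen function. Uniqueness evaluates the transform only at real
    points [sigma + 1 + n]: under x = exp (- t) it becomes a Hausdorff moment problem, settled by
    explicit peaking polynomials instead of Weierstrass approximation. The transform of a mode is
    derived from its differential equation and a growth bound alone, so the three damping regimes
    share one computation and the roots of m s^2 + D s + lambda never appear. The mode of eigenvalue
    0 does not decay: its limit 1 / D produces the steady state, and it is split off before any
    estimate. *)

Section ExpIntegrals.
Variable R : realType.
Notation mu := (@lebesgue_measure R).
Implicit Types (f F : R -> R) (a e K l t : R).

Lemma is_derive_expRM a t :
  is_derive t 1 (fun t => expR (a * t)) (a * expR (a * t)).
Proof.
apply: is_derive_eq; last by rewrite /= !scaler1 [RHS]mulrC.
Qed.

Lemma continuous_is_derive f (df : R -> R) :
  (forall t, is_derive t 1 f (df t)) -> continuous f.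
Proof.
by move=> h t; apply/differentiable_continuous/derivable1_diffP; case: (h t).
Qed.

Lemma ge0_FTC2y f F l :
  (forall t, 0 <= t -> 0 <= f t) -> continuous f ->
  (forall t, is_derive t 1 F (f t)) -> F x @[x --> +oo] --> l ->
  (\int[mu]_(t in `[0%R, +oo[) (f t)%:E = l%:E - (F 0)%:E)%E.
Proof.
move=> f0 cf dF Fl; apply: ge0_continuous_FTC2y => //.
- exact: continuous_subspaceT.
- exact/cvg_at_right_filter/(continuous_is_derive dF).
- by move=> t _; rewrite derive1E; case: (dF t).
Qed.

Lemma cvg_expRM0 a : a < 0 -> expR (a * x) @[x --> +oo] --> (0 : R).
Proof.
move=> a0; apply/cvgrPdist_le => e e0; near=> t.
rewrite sub0r normrN ger0_norm ?expR_ge0//.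
rewrite -[a * t]opprK -mulNr expRN -[leRHS]invrK lef_pV2 ?posrE ?expR_gt0
  ?invr_gt0//.
apply: le_trans (expR_ge1Dx _); rewrite -lerBlDl -ler_pdivrMl ?oppr_gt0//.
Unshelve. all: end_near. Qed.

Lemma ge0_integrable_FTC2y f F l :
  (forall t, 0 <= t -> 0 <= f t) -> continuous f ->
  (forall t, is_derive t 1 F (f t)) -> F x @[x --> +oo] --> l ->
  mu.-integrable `[0%R, +oo[ (EFin \o f).
Proof.
move=> f0 cf dF Fl; apply/integrableP; split.
  apply/measurable_EFinP; apply: measurable_funTS.
  exact: continuous_measurable_fun.
under eq_integral => t.
  rewrite inE/= in_itv/= andbT => t0.
  by rewrite ger0_norm ?f0//; over.
by rewrite (ge0_FTC2y f0 cf dF Fl) -EFinB ltry.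
Qed.


Lemma integrable_expRM a : a < 0 ->
  mu.-integrable `[0, +oo[ (EFin \o (fun t => expR (a * t))).
Proof.
move=> a0; have dF t : is_derive t 1 (fun t => a^-1 * expR (a * t)) (expR (a *
  t)).
  have := is_deriveZ (a^-1) (is_derive_expRM a t).
  by rewrite /GRing.scale/= mulKf ?lt_eqF.
apply: (ge0_integrable_FTC2y (l := a^-1 * 0) _ _ dF).
- by move=> t _; exact: expR_ge0.
- exact: continuous_is_derive (is_derive_expRM a).
- by apply: cvgMr; exact: cvg_expRM0.
Qed.

(* Adding the dominating exponential makes the integrand nonnegative, which
   reduces the signed case to the library's [ge0_continuous_FTC2y]. *)
Lemma Rintegral_FTC2y f F K e : 0 < e -> continuous f ->
  (forall t, is_derive t 1 F (f t)) ->
  (forall t, 0 <= t -> `|f t| <= K * expR (- e * t)) ->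
  (forall t, 0 <= t -> `|F t| <= K * expR (- e * t)) ->
  mu.-integrable `[0, +oo[ (EFin \o f) /\
  \int[mu]_(t in `[0, +oo[) f t = - F 0.
Proof.
move=> e0 cf dF fK FK.
pose h t := K * expR (- e * t); pose H t := - (K / e) * expR (- e * t).
have dh t : is_derive t 1 h (K * (- e * expR (- e * t))).
  exact: (is_deriveZ K (is_derive_expRM _ _)).
have ch : continuous h by exact: continuous_is_derive dh.
have dH t : is_derive t 1 H (h t).
  apply: (is_derive_eq (is_deriveZ (- (K / e)) (is_derive_expRM (- e) t))).
  by rewrite /GRing.scale/= /h; field; rewrite gt_eqF.
have dFH t : is_derive t 1 (F + H) ((f + h) t) by exact: is_deriveD.
have h0 t : 0 <= t -> 0 <= h t by move=> t0; exact: le_trans (fK t t0).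
have fh0 t : 0 <= t -> 0 <= (f + h) t.
  by move=> t0; have := fK t t0; rewrite ler_norml -/(h t) fctE => /andP[]; lra.
have cfh : continuous (f + h) by move=> t; apply: cvgD; [exact: cf|exact: ch].
have eN : - e < 0 by rewrite oppr_lt0.
have H0 : H x @[x --> +oo] --> 0.
  by rewrite -(mulr0 (- (K / e))); apply: cvgMr; exact: cvg_expRM0.
have hoo : h x @[x --> +oo] --> 0.
  by rewrite -(mulr0 K); apply: cvgMr; exact: cvg_expRM0.
have F0 : F x @[x --> +oo] --> 0.
  apply: (squeeze_cvgr _ _ hoo); last by rewrite -[X in _ --> X]oppr0;
    apply: cvgN hoo.
  by near=> t; rewrite -ler_norml; apply: FK; near: t; exact: nbhs_pinfty_ge.
have FH0 : (F + H) x @[x --> +oo] --> 0 by rewrite -(addr0 0); exact: cvgD.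
have ih := ge0_integrable_FTC2y h0 ch dH H0.
have ifh := ge0_integrable_FTC2y fh0 cfh dFH FH0.
have fE : f = (fun t => (f + h) t - h t) by apply/funext => t;
  rewrite fctE addrK.
rewrite fE; split.
  by apply: eq_integrable (integrableB _ ifh ih) => // t _; rewrite /= EFinB.
rewrite RintegralB// /Rintegral (ge0_FTC2y fh0 cfh dFH FH0).
by rewrite (ge0_FTC2y h0 ch dH H0) -!EFinB/= !fctE; lra.
Unshelve. all: end_near. Qed.

End ExpIntegrals.

(** * Uniqueness of inverse Laplace transforms *)

Section Uniqueness.
Variable R : realType.
Notation mu := (@lebesgue_measure R).
Implicit Types (f g : R -> R) (t sigma : R).

Lemma bernoulli_ineq (x : R) n : 0 <= x -> 1 + n%:R * x <= (1 + x) ^+ n.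
Proof.
move=> x0; elim: n => [|n IH]; first by rewrite mul0r addr0 expr0.
rewrite exprS; apply: le_trans (ler_wpM2l _ IH); last lra.
by have := ler0n R n; rewrite -natr1; nra.
Qed.

(** Under x = exp (- t) these are the moments of g (- ln x) / x on ]0, 1]. *)
Definition null_moments g := forall n : nat,
  mu.-integrable `[0%R, +oo[ (EFin \o (fun t => expR (- t) ^+ n * g t)) /\
  \int[mu]_(t in `[0%R, +oo[) (expR (- t) ^+ n * g t) = 0.

Lemma null_moments_horner g (p : {poly R}) : null_moments g ->
  mu.-integrable `[0%R, +oo[ (EFin \o (fun t => p.[expR (- t)] * g t)) /\
  \int[mu]_(t in `[0%R, +oo[) (p.[expR (- t)] * g t) = 0.
Proof.
move=> g0.
(* [poly_ind] builds polynomials as [p * 'X + c%:P]; the extra power [n] absorbs the factor ['X]. *)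
have h n : mu.-integrable `[0%R, +oo[
      (EFin \o (fun t => p.[expR (- t)] * (expR (- t) ^+ n * g t))) /\
    \int[mu]_(t in `[0%R, +oo[) (p.[expR (- t)] * (expR (- t) ^+ n * g t)) = 0.
  elim/poly_ind: p n => [|p c IH] n.
    have E : (fun t => (0 : {poly R}).[expR (- t)] * (expR (- t) ^+ n * g t)) =
      cst 0.
      by apply/funext => t; rewrite horner0 mul0r.
    by rewrite E Rintegral_cst// mul0r; split=> //; exact: integrable0.
  have E : (fun t => (p * 'X + c%:P).[expR (- t)] * (expR (- t) ^+ n * g t)) =
     (fun t => p.[expR (- t)] * (expR (- t) ^+ n.+1 * g t) +
               c * (expR (- t) ^+ n * g t)).
    by apply/funext => t; rewrite hornerMXaddC exprS; ring.
  have [i1 z1] := IH n.+1; have [i2 z2] := g0 n.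
  have i3 : mu.-integrable `[0%R, +oo[
      (EFin \o (fun t => c * (expR (- t) ^+ n * g t))).
    by apply: eq_integrable (integrableZl _ c i2).
  rewrite E; split.
    by apply: eq_integrable (integrableD _ i1 i3).
  by rewrite RintegralD// RintegralZl// z1 z2 mulr0 addr0.
have E : (fun t => p.[expR (- t)] * (expR (- t) ^+ 0 * g t)) =
         (fun t => p.[expR (- t)] * g t).
  by apply/funext => t; rewrite expr0 mul1r.
by have := h 0; rewrite E.
Qed.

(* The kernels [P ^+ N], with [P] a polynomial in [exp (- t)] exceeding [1] only
   near [t0], blow up around [t0] and stay below [1] elsewhere, so that they
   would give a positive moment to a function positive around [t0]. *)
Lemma null_moments_le0 g t0 : null_moments g -> 0 < t0 ->
  {for t0, continuous g} -> g t0 <= 0.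
Proof.
move=> g0 t00 cg; rewrite leNgt; apply/negP => gt0.
set gam := g t0 / 2; have gam0 : 0 < gam by rewrite divr_gt0.
have /cvgrPdist_lt/(_ gam gam0) := cg.
case/nbhs_ballP => rho0/= rho00 hrho0.
(* Halving puts the closed interval of radius [rho] inside the ball where [g] exceeds [gam] and
   keeps it at positive times. *)
pose rho := Num.min (rho0 / 2) (t0 / 2).
have rho_gt0 : 0 < rho by rewrite lt_min !divr_gt0.
have rho_t0 : rho < t0 by rewrite gt_min; apply/orP; right; lra.
have rhoP t : `|t - t0| <= rho -> gam <= g t.
  move=> ht; have : ball t0 rho0 t.
    rewrite /ball/= distrC; apply: le_lt_trans ht _.
    by rewrite gt_min; apply/orP; left; move: rho00 => /=; lra.
  move=> /hrho0/=; rewrite ltr_norml /gam => /andP[_]; lra.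
pose q t := expR (- t).
(* [q] is decreasing, so [kap] separates [q t0] from every value of [q] at distance at least [rho]
   from [t0]. *)
pose kap := Num.min (q t0 - q (t0 + rho)) (q (t0 - rho) - q t0).
have kap0 : 0 < kap by rewrite lt_min !subr_gt0 !ltr_expR; apply/andP; split;
  lra.
have kapP t : rho <= `|t - t0| -> kap <= `|q t - q t0|.
  have k1 : kap <= q t0 - q (t0 + rho) by rewrite ge_min lexx.
  have k2 : kap <= q (t0 - rho) - q t0 by rewrite ge_min lexx orbT.
  rewrite !ler_normr => /orP[] h; apply/orP; [right|left].
    have : q t <= q (t0 + rho) by rewrite ler_expR; lra.
    lra.
  have : q (t0 - rho) <= q t by rewrite ler_expR; lra.
  lra.
pose c := kap ^+ 2.
have c0 : 0 < c by rewrite exprn_gt0.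
have cq : continuous q.
  by move=> t; apply: continuous_comp;
    [exact: opp_continuous|exact: continuous_expR].
have /cvgrPdist_lt/(_ (kap / 2)) := cq t0.
rewrite divr_gt0// => /(_ isT).
case/nbhs_ballP => eta0/= eta00 heta0.
pose eta := Num.min eta0 rho.
have eta_gt0 : 0 < eta by rewrite lt_min eta00.
have etaP t : `|t - t0| < eta -> (q t - q t0) ^+ 2 <= c / 2.
  move=> ht; have : ball t0 eta0 t.
    by rewrite /ball/= distrC; apply: lt_le_trans ht _; rewrite ge_min lexx.
  move=> /heta0/=; rewrite ltr_norml /c => /andP[]; nra.
(* At [q t], [P] is at least [1 + c / 2] within [eta] of [t0], at most 1 from distance [rho] on, and
   nonnegative for all [t >= 0] since [q] then lies in ]0, 1]. *)
pose P : {poly R} := (1 + c)%:P - ('X - (q t0)%:P) ^+ 2.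
have PE t : P.[q t] = 1 + c - (q t - q t0) ^+ 2.
  by rewrite /P !hornerE.
have P_ge0 t : 0 <= t -> 0 <= P.[q t].
  move=> t_ge0; rewrite PE.
  have : 0 < q t <= 1 by rewrite expR_gt0 expR_le1 oppr_le0.
  have : 0 < q t0 <= 1 by rewrite expR_gt0 expR_le1 oppr_le0 ltW.
  nra.
(* On [J] Bernoulli's inequality gives [P ^+ N * g >= A]; up to distance [rho] this product is
   nonnegative, and beyond it is at most [|g|] in absolute value. So [- P ^+ N * g], of integral 0,
   lies below [|g| - A * \1_J]. The right-hand side does not depend on [N], which yields the
   contradiction. *)
have hN N : (1 + N%:R * (c / 2)) * gam * (eta *+ 2) <=
    \int[mu]_(t in `[0%R, +oo[) `|g t|.
  have [iP zP] := null_moments_horner (- P ^+ N) g0.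
  have ig : mu.-integrable `[0%R, +oo[ (EFin \o g).
    have [+ _] := g0 0; apply: eq_integrable => // t _.
    by rewrite /= expr0 mul1r.
  have ig1 := integrable_norm ig.
  pose J := `]t0 - eta, t0 + eta[%classic.
  pose A := (1 + N%:R * (c / 2)) * gam.
  have A0 : 0 <= A.
    by rewrite mulr_ge0 ?(ltW gam0)// addr_ge0// mulr_ge0 ?ler0n ?divr_ge0//
      ltW.
  have iJ : mu.-integrable `[0%R, +oo[ (EFin \o (\1_J : R -> R)).
    apply: (@integrableS _ _ _ _ setT) => //; exact: integrable_indic_itv.
  have iAJ : mu.-integrable `[0%R, +oo[ (EFin \o (fun t => A * \1_J t)).
    by apply: eq_integrable (integrableZl _ A iJ).
  have JE : \int[mu]_(t in `[0%R, +oo[) (\1_J t) = eta *+ 2.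
    rewrite /Rintegral integral_indic//; last exact: measurable_itv.
    rewrite setIidl; last first.
      have eta_rho : eta <= rho by rewrite ge_min lexx orbT.
      by move=> t; rewrite /J/= !in_itv/= andbT => /andP[h _]; lra.
    have JE : mu J = (eta *+ 2)%:E.
      rewrite lebesgue_measure_itv/= lte_fin ifT; last lra.
      by rewrite -EFinD/=; congr EFin; ring.
    exact: (congr1 fine JE).
  rewrite -[X in _ * X]JE -RintegralZl// -/A.
  rewrite -subr_ge0 -RintegralB// -[X in X <= _]zP.
  apply: le_Rintegral => //.
    by apply: eq_integrable (integrableB _ ig1 iAJ) => // t _; rewrite /= EFinB.
  move=> t; rewrite /= in_itv/= andbT => t_ge0.
  rewrite hornerN horner_exp -/(q t) mulNr.
  have PN0 : 0 <= P.[q t] ^+ N by rewrite exprn_ge0// P_ge0.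
  rewrite indicE; case: (boolP (t \in J)) => tJ; rewrite ?mulr1 ?mulr0 ?subr0.
    have ht : `|t - t0| < eta.
      by move: tJ; rewrite /J inE/= in_itv/= ltr_norml => /andP[? ?];
        apply/andP; split; lra.
    have gt : gam <= g t.
      by apply/rhoP/ltW; apply: lt_le_trans ht _; rewrite ge_min lexx orbT.
    suff : A <= P.[q t] ^+ N * g t by have := normr_ge0 (g t); lra.
    apply: ler_pM => //; rewrite ?(ltW gam0)//.
      by rewrite addr_ge0// mulr_ge0 ?ler0n// divr_ge0// ltW.
    apply: (@le_trans _ _ ((1 + c / 2) ^+ N)).
      by rewrite bernoulli_ineq// divr_ge0// ltW.
    by rewrite lerXn2r ?nnegrE ?P_ge0// ?addr_ge0 ?divr_ge0 ?(ltW c0)// PE;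
      have := etaP t ht; lra.
  have [ht|ht] := leP `|t - t0| rho.
    have gt := rhoP _ ht.
    have := normr_ge0 (g t).
    have : 0 <= P.[q t] ^+ N * g t by rewrite mulr_ge0// (le_trans (ltW gam0)).
    lra.
  have P1 : P.[q t] ^+ N <= 1.
    rewrite exprn_ile1 ?P_ge0// PE /c -[(q t - _) ^+ 2]ger0_norm ?sqr_ge0//
      normrX.
    have := kapP t (ltW ht); nra.
  rewrite -mulrN -normrN; apply: le_trans (ler_norm _) _.
  by rewrite normrM (ger0_norm PN0) ler_piMl.
have G0 : 0 <= \int[mu]_(t in `[0%R, +oo[) `|g t| by apply: Rintegral_ge0.
set G := \int[mu]_(t in `[0%R, +oo[) `|g t| in hN G0.
have k0 : 0 < c / 2 * gam * (eta *+ 2).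
  by rewrite !mulr_gt0// ?invr_gt0// pmulrn_lgt0.
have := archi_boundP (divr_ge0 G0 (ltW k0)).
rewrite ltr_pdivrMr// => h.
have := hN (Num.bound (G / (c / 2 * gam * (eta *+ 2)))).
have : 0 < gam * (eta *+ 2) by rewrite mulr_gt0// pmulrn_lgt0.
move: h; set N := Num.bound _; set n := N%:R; set e2 := eta *+ 2.
lra.
Unshelve. all: end_near. Qed.

End Uniqueness.

(** * Linearity and injectivity of the Laplace transform *)

Section InverseLaplace.
Variable R : realType.
Notation mu := (@lebesgue_measure R).
Implicit Types (f g : R -> R) (F G : R[i] -> R[i]) (t sigma a : R) (s : R[i]).

Lemma integrable_expRMb f x (h : R -> R) :
  (forall t, `|h t| <= 1) -> measurable_fun setT h ->
  mu.-integrable `[0%R, +oo[ (EFin \o (fun t => expR (- (x * t)) * f t)) ->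
  mu.-integrable `[0%R, +oo[ (EFin \o (fun t => expR (- (x * t)) * h t * f t)).
Proof.
move=> h1 mh fi; have := fi => /integrableP[mf _].
apply: le_integrable fi => //.
  have E : (fun t => expR (- (x * t)) * h t * f t) =
           (fun t => h t * (expR (- (x * t)) * f t)).
    by apply/funext => t; ring.
  rewrite E; apply/measurable_EFinP; apply: measurable_funM.
    exact: measurable_funTS.
  exact/measurable_EFinP.
move=> t _; rewrite /= lee_fin mulrAC normrM ler_piMr//.
Qed.

Lemma integrable_laplace f s :
  mu.-integrable `[0%R, +oo[ (EFin \o (fun t => expR (- (complex.Re s * t)) * f
    t)) ->
  mu.-integrable `[0%R, +oo[
     (EFin \o (fun t => expR (- (complex.Re s * t)) * cos (complex.Im s * t) * f
       t)) /\
  mu.-integrable `[0%R, +oo[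
     (EFin \o (fun t => expR (- (complex.Re s * t)) * sin (complex.Im s * t) * f
       t)).
Proof.
move=> fi; split; apply: integrable_expRMb => //.
- by move=> t; rewrite ler_norml cos_geN1 cos_le1.
- apply: continuous_measurable_fun => t.
  by apply: continuous_comp; [exact: mulrl_continuous|exact: continuous_cos].
- by move=> t; rewrite ler_norml sin_geN1 sin_le1.
- apply: continuous_measurable_fun => t.
  by apply: continuous_comp; [exact: mulrl_continuous|exact: continuous_sin].
Qed.

Lemma is_inverse_laplace0 : @is_inverse_laplace R (fun=> 0) (fun=> 0).
Proof.
split; first by apply: continuous_subspaceT => t; exact: cvg_cst.
exists 0 => s _; split.
  by apply: eq_integrable (integrable0 _ _) => // t _; rewrite /= mulr0.
rewrite /laplace; under eq_Rintegral do rewrite mulr0.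
under [in X in Complex _ X]eq_Rintegral do rewrite mulr0.
by rewrite !Rintegral_cst// !mul0r oppr0.
Qed.

Lemma is_inverse_laplace_lin F G f g a :
  is_inverse_laplace F f -> is_inverse_laplace G g ->
  is_inverse_laplace (fun s => a%:C * F s + G s) (fun t => a * f t + g t).
Proof.
move=> [cf [s1 h1]] [cg [s2 h2]]; split.
  move=> t; apply: cvgD; last exact: cg.
  by apply: cvgMr; exact: cf.
exists (Num.max s1 s2) => s; rewrite gt_max => /andP[/h1[fi <-] /h2[gi <-]].
have [fc fs] := integrable_laplace fi; have [gc gs] := integrable_laplace gi.
(* The weight [h] is later the exponential alone, for absolute convergence, and its products with
   cosine and sine, for the two parts of the transform. *)
have lin (h : R -> R) : mu.-integrable `[0%R,
  +oo[ (EFin \o (fun t => h t * f t)) ->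
    mu.-integrable `[0%R, +oo[ (EFin \o (fun t => h t * g t)) ->
    mu.-integrable `[0%R, +oo[ (EFin \o (fun t => h t * (a * f t + g t))) /\
    \int[mu]_(t in `[0%R, +oo[) (h t * (a * f t + g t)) =
      a * \int[mu]_(t in `[0%R, +oo[) (h t * f t) +
      \int[mu]_(t in `[0%R, +oo[) (h t * g t).
  move=> hf hg.
  have E : (fun t => h t * (a * f t + g t)) =
           (fun t => a * (h t * f t) + h t * g t).
    by apply/funext => t; ring.
  have hf' : mu.-integrable `[0%R, +oo[ (EFin \o (fun t => a * (h t * f t))).
    by apply: eq_integrable (integrableZl _ a hf).
  rewrite E RintegralD// RintegralZl//; split=> //.
  by apply: eq_integrable (integrableD _ hf' hg).
split; first by have [] := lin _ fi gi.
have [_ ic] := lin _ fc gc; have [_ is_] := lin _ fs gs.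
rewrite /laplace ic is_; apply/eqP; rewrite eq_complex /=.
by apply/andP; split; apply/eqP; ring.
Qed.

(** Lets a transform be rewritten on a half-plane free of poles, whatever the default values of
    inverses elsewhere. *)
Lemma eq_is_inverse_laplace F G f sigma :
  (forall s, sigma < complex.Re s -> F s = G s) ->
  is_inverse_laplace F f -> is_inverse_laplace G f.
Proof.
move=> FG [cf [s1 h1]]; split=> //; exists (Num.max s1 sigma) => s.
by rewrite gt_max => /andP[/h1[fi ->] /FG].
Qed.

Lemma is_inverse_laplace_sum (I : finType) (F : I -> R[i] -> R[i])
    (f : I -> R -> R) (a : I -> R) :
  (forall k, is_inverse_laplace (F k) (f k)) ->
  is_inverse_laplace (fun s => \sum_k (a k)%:C * F k s) (fun t => \sum_k a k * f
    k t).
Proof.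
move=> h; elim: (index_enum I) => [|k e IH].
  rewrite (_ : (fun s => _) = fun=> 0); last by apply/funext => s;
    rewrite big_nil.
  rewrite (_ : (fun t => \sum_(k <- [::]) _) = fun=> 0).
    exact: is_inverse_laplace0.
  by apply/funext => t; rewrite big_nil.
have := is_inverse_laplace_lin (a k) (h k) IH.
congr is_inverse_laplace; apply/funext => x; rewrite big_cons//.
Qed.

(** Damping [f] by exp (- (sigma + 1) t) turns the values of the transform at the real points
    [sigma + 1 + n] into null moments. The one-sided bound for [f] and for [- f] gives 0 at positive
    times, and right continuity gives it at time 0. *)
Lemma null_inverse_laplace f : is_inverse_laplace (fun=> 0) f ->
  forall t, 0 <= t -> f t = 0.
Proof.
have le0 g t : is_inverse_laplace (fun=> 0) g -> 0 < t -> g t <= 0.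
  move=> [cg [sigma h]] t0.
  pose g1 t := expR (- ((sigma + 1) * t)) * g t.
  have m1 : null_moments g1.
    move=> n; have := h (sigma + 1 + n%:R)%:C.
    have /[swap]/[apply] : sigma < complex.Re (sigma + 1 + n%:R)%:C.
      by rewrite /=; have := ler0n R n; lra.
    have E t' : expR (- t') ^+ n * g1 t' =
      expR (- ((sigma + 1 + n%:R) * t')) * g t'.
      rewrite /g1 mulrA -expRM_natl -expRD; congr (expR _ * _); ring.
    rewrite /= => -[i1 /eqP]; rewrite eq_complex => /andP[/= /eqP z1 _].
    under eq_Rintegral do rewrite E.
    split; last first.
      by rewrite -[RHS]z1; apply: eq_Rintegral => u _; rewrite mul0r cos0 mulr1.
    by apply: eq_integrable i1 => // u _; rewrite /= E.
  have ct : {for t, continuous g1}.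
    apply: continuousM.
      apply: continuous_comp; last exact: continuous_expR.
      apply: continuousN; exact: mulrl_continuous.
    move: cg => /continuous_within_itvcyP[cg _]; apply: cg.
    by rewrite in_itv/= t0.
  by have := null_moments_le0 m1 t0 ct; rewrite pmulr_rle0// expR_gt0.
move=> hf.
have f0 t : 0 < t -> f t = 0.
  move=> t0; apply/eqP; rewrite eq_le le0//= -oppr_le0.
  have := is_inverse_laplace_lin (-1) hf is_inverse_laplace0.
  rewrite (_ : (fun s => _) = fun=> 0); last first.
    by apply/funext => s; rewrite mulr0 addr0.
  by move=> /le0/(_ t0); rewrite mulN1r addr0.
move=> t; rewrite le_eqVlt => /predU1P[<-|]; last exact: f0.
have [/continuous_within_itvcyP[_ c0] _] := hf.
apply: (cvg_unique _ c0) => //.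
apply: cvg_near_cst; near=> u; apply: f0; near: u; exact: nbhs_right_gt.
Unshelve. all: end_near. Qed.

(** Since [f] exists, the choice made by [xget] is itself an inverse transform of [F], and its
    difference with [f] has transform 0. *)
Lemma inverse_laplaceE F f t : is_inverse_laplace F f -> 0 <= t ->
  inverse_laplace F t = f t.
Proof.
move=> hf t0; have hF : is_inverse_laplace F (inverse_laplace F).
  by apply: (xgetPex (fun=> 0)); exists f.
have := is_inverse_laplace_lin (-1) hf hF.
rewrite (_ : (fun s => _) = fun=> 0); last first.
  by apply/funext => s; rewrite rmorphN1 mulN1r addNr.
by move=> /null_inverse_laplace/(_ _ t0); lra.
Qed.

End InverseLaplace.

(** * The modes *)

Section Modes.
Variable R : realType.
Notation mu := (@lebesgue_measure R).
Implicit Types (f g : R -> R) (k x y t m D l : R).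

(** This rule and the next ones use explicit abstractions and plain multiplication instead of [*:],
    so that they nest by unification in long derivatives. *)
Lemma is_derive_mul f g t (a b : R) : is_derive t 1 f a -> is_derive t 1 g b ->
  is_derive t 1 (fun u => f u * g u) (a * g t + f t * b).
Proof.
move=> df dg; apply: (is_derive_eq (is_deriveM df dg)).
by rewrite /GRing.scale/=; ring.
Qed.

Lemma is_derive_add f g t (a b : R) : is_derive t 1 f a -> is_derive t 1 g b ->
  is_derive t 1 (fun u => f u + g u) (a + b).
Proof. by move=> df dg; exact: is_deriveD. Qed.

Lemma is_derive_sub f g t (a b : R) : is_derive t 1 f a -> is_derive t 1 g b ->
  is_derive t 1 (fun u => f u - g u) (a - b).
Proof. by move=> df dg; exact: is_deriveB. Qed.

Lemma is_derive_cmul (c : R) f t (a : R) : is_derive t 1 f a ->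
  is_derive t 1 (fun u => c * f u) (c * a).
Proof. by move=> df; exact: is_deriveZ. Qed.

Lemma is_derive_sinM c t : is_derive t 1 (fun u => sin (c * u)) (c * cos (c *
  t)).
Proof.
apply: (is_derive_eq (is_derive1_comp (is_derive_sin (c * t)) (is_derive_cmul c
  (is_derive_id t 1)))).
by rewrite mulr1 mulrC.
Qed.

Lemma is_derive_cosM c t : is_derive t 1 (fun u => cos (c * u)) (- (c * sin (c *
  t))).
Proof.
apply: (is_derive_eq (is_derive1_comp (is_derive_cos (c * t)) (is_derive_cmul c
  (is_derive_id t 1)))).
by rewrite mulr1 mulrC mulrN.
Qed.

(* The solutions of [u'' = k u] with [u 0 = 0], [u' 0 = 1], respectively
   [u 0 = 1], [u' 0 = 0]. *)
Definition sinhc k t : R :=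
  if 0 < k then (expR (Num.sqrt k * t) - expR (- Num.sqrt k * t)) / (2 *
    Num.sqrt k)
  else if k < 0 then sin (Num.sqrt (- k) * t) / Num.sqrt (- k)
  else t.

Definition coshc k t : R :=
  if 0 < k then (expR (Num.sqrt k * t) + expR (- Num.sqrt k * t)) / 2
  else if k < 0 then cos (Num.sqrt (- k) * t)
  else 1.

Lemma is_derive_sinhc k t : is_derive t 1 (sinhc k) (coshc k t).
Proof.
rewrite /sinhc /coshc; case: (ltgtP k 0) => k0.
- have r0 : Num.sqrt (- k) != 0 by rewrite gt_eqF// sqrtr_gt0 oppr_gt0.
  have := is_derive_mul (is_derive_sinM (Num.sqrt (- k)) t)
    (is_derive_cst (Num.sqrt (- k))^-1 t 1).
  move=> h; apply: (is_derive_eq h); rewrite /cst; field.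
  exact: r0.
- have r0 : Num.sqrt k != 0 by rewrite gt_eqF// sqrtr_gt0.
  have := is_derive_mul
     (is_derive_sub (is_derive_expRM (Num.sqrt k) t) (is_derive_expRM (-
       Num.sqrt k) t))
    (is_derive_cst (2 * Num.sqrt k)^-1 t 1).
  by move=> h; apply: (is_derive_eq h); rewrite /cst; field.
- exact: is_derive_id.
Qed.

Lemma is_derive_coshc k t : is_derive t 1 (coshc k) (k * sinhc k t).
Proof.
rewrite /sinhc /coshc; case: (ltgtP k 0) => k0.
- have r0 : Num.sqrt (- k) != 0 by rewrite gt_eqF// sqrtr_gt0 oppr_gt0.
  have k2 : k = - (Num.sqrt (- k)) ^+ 2 by rewrite sqr_sqrtr ?opprK//
    oppr_ge0 ltW.
  apply: (is_derive_eq (is_derive_cosM (Num.sqrt (- k)) t)).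
  by move: r0 k2; move: (Num.sqrt (- k)) => r r0 k2; rewrite [in RHS]k2; field.
- have r0 : Num.sqrt k != 0 by rewrite gt_eqF// sqrtr_gt0.
  have k2 : k = (Num.sqrt k) ^+ 2 by rewrite sqr_sqrtr// ltW.
  have := is_derive_mul
     (is_derive_add (is_derive_expRM (Num.sqrt k) t) (is_derive_expRM (-
       Num.sqrt k) t))
    (is_derive_cst (2^-1 : R) t 1).
  move=> h; apply: (is_derive_eq h); rewrite /cst.
  by move: r0 k2; move: (Num.sqrt k) => r r0 ->; field.
- by rewrite k0 mul0r; exact: is_derive_cst.
Qed.

Lemma sinhc0 k : sinhc k 0 = 0.
Proof. by rewrite /sinhc !mulr0 subrr sin0 !mul0r; case: ifP => // _;
  case: ifP. Qed.

Lemma coshc0 k : coshc k 0 = 1.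
Proof.
rewrite /coshc !mulr0 cos0 expR0; case: ifP => _; last by case: ifP.
by field.
Qed.

Lemma ler_expRM (a b : R) t : 0 <= t -> a <= b -> expR (a * t) <= expR (b * t).
Proof. by move=> t0 ab; rewrite ler_expR ler_wpM2r. Qed.

(* [Num.sqrt k] is [0] for negative [k]. *)
Lemma sinhc_bound k (rho : R) : Num.sqrt k <= rho -> (k = 0 -> 0 < rho) ->
  exists2 K, 0 <= K & forall t, 0 <= t -> `|sinhc k t| <= K * expR (rho * t).
Proof.
move=> krho k0rho; have rho0 : 0 <= rho by rewrite (le_trans _ krho) ?sqrtr_ge0.
rewrite /sinhc; case: (ltgtP k 0) => k0.
- have r0 : 0 < Num.sqrt (- k) by rewrite sqrtr_gt0 oppr_gt0.
  exists (Num.sqrt (- k))^-1 => [|t t0]; first by rewrite invr_ge0 ltW.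
  rewrite normrM [`|_^-1|]ger0_norm ?invr_ge0 ?(ltW r0)// mulrC ler_wpM2l//.
  apply: (@le_trans _ _ 1); first by rewrite ler_norml sin_geN1 sin_le1.
  by rewrite -expR0 ler_expR mulr_ge0.
- have r0 : 0 < Num.sqrt k by rewrite sqrtr_gt0.
  exists (2 * Num.sqrt k)^-1 => [|t t0];
    first by rewrite invr_ge0 mulr_ge0// ltW.
  rewrite normrM [`|_^-1|]ger0_norm ?invr_ge0 ?mulr_ge0 ?(ltW r0)// mulrC.
  rewrite ler_wpM2l// ?invr_ge0 ?mulr_ge0 ?(ltW r0)//.
  have := ler_expRM t0 krho.
  have : expR (- Num.sqrt k * t) <= expR (Num.sqrt k * t) by apply: ler_expRM =>
    //; lra.
  have := expR_gt0 (- Num.sqrt k * t).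
  rewrite ler_norml => *; apply/andP; split; lra.
(* Here [sinhc] is t itself, and 1 + rho t <= exp (rho t) bounds it; only this case needs
   [rho > 0]. *)
- exists rho^-1 => [|t t0]; first by rewrite invr_ge0.
  rewrite ger0_norm// ler_pdivlMl; last exact: k0rho.
  apply: le_trans (expR_ge1Dx _); lra.
Qed.

Lemma coshc_bound k t : 0 <= t -> `|coshc k t| <= expR (Num.sqrt k * t).
Proof.
move=> t0; have e1 : 1 <= expR (Num.sqrt k * t).
  by rewrite -expR0 ler_expR mulr_ge0// sqrtr_ge0.
rewrite /coshc; case: (ltgtP k 0) => k0; last by rewrite normr1.
  by apply: le_trans e1; rewrite ler_norml cos_geN1 cos_le1.
have : expR (- Num.sqrt k * t) <= expR (Num.sqrt k * t).
  by apply: ler_expRM => //; have := sqrtr_ge0 k; lra.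
have := expR_gt0 (- Num.sqrt k * t).
rewrite ler_norml => *; apply/andP; split; lra.
Qed.

(** The factor [m^-1] is the initial velocity due to a unit impulse. *)
Definition mode m D l t : R :=
  m^-1 * (expR (- (D / (2 * m)) * t) * sinhc ((D / (2 * m)) ^+ 2 - l / m) t).

Definition dmode m D l t : R :=
  let a := D / (2 * m) in let k := a ^+ 2 - l / m in
  m^-1 * (expR (- a * t) * (coshc k t + - a * sinhc k t)).

Lemma is_derive_mode m D l t : is_derive t 1 (mode m D l) (dmode m D l t).
Proof.
have := is_derive_cmul m^-1 (is_derive_mul (is_derive_expRM (- (D / (2 * m))) t)
  (is_derive_sinhc ((D / (2 * m)) ^+ 2 - l / m) t)).
by move=> h; apply: (is_derive_eq h); rewrite /dmode; ring.
Qed.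

(** If u'' = k u, then f = exp (- a t) u satisfies f'' + 2 a f' + (a^2 - k) f = 0; here 2 a = D / m
    and a^2 - k = l / m. *)
Lemma is_derive_dmode m D l t : m != 0 ->
  is_derive t 1 (dmode m D l) (- (D * dmode m D l t + l * mode m D l t) / m).
Proof.
move=> m0; rewrite /dmode /mode.
set k := (D / (2 * m)) ^+ 2 - l / m.
have := is_derive_cmul m^-1 (is_derive_mul (is_derive_expRM (- (D / (2 * m))) t)
  (is_derive_add (is_derive_coshc k t) (is_derive_cmul (- (D / (2 * m)))
    (is_derive_sinhc k t)))).
move=> h; apply: (is_derive_eq h).
set E := expR _; set S := sinhc _ _; set Ch := coshc _ _.
by rewrite /k; field.
Qed.

(** [sinhc] may grow at rate [a - alpha], which exp (- a t) turns into decay at rate [alpha]. At k =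
    0 its linear growth costs a strict inequality. *)
Lemma mode_bound m D l (alpha : R) : 0 < m ->
  alpha <= D / (2 * m) - Num.sqrt ((D / (2 * m)) ^+ 2 - l / m) ->
  ((D / (2 * m)) ^+ 2 - l / m = 0 -> alpha < D / (2 * m)) ->
  exists2 K, 0 <= K & forall t, 0 <= t ->
    `|mode m D l t| <= K * expR (- alpha * t).
Proof.
move=> m0; rewrite /mode; set a := D / (2 * m).
set k := a ^+ 2 - l / m => h1 h2.
have [||K K0 hK] := @sinhc_bound k (a - alpha); [lra| |].
  by move=> /h2; lra.
exists (m^-1 * K) => [|t t0]; first by rewrite mulr_ge0// invr_ge0 ltW.
rewrite normrM ger0_norm ?invr_ge0 ?(ltW m0)// -mulrA.
rewrite ler_wpM2l ?invr_ge0 ?(ltW m0)// normrM ger0_norm ?expR_ge0//.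
apply: (le_trans (ler_wpM2l (expR_ge0 _) (hK t t0))).
rewrite mulrCA -expRD ler_wpM2l// ler_expR; lra.
Qed.

(** Serves only the absolute convergence for large real part of s, so the rate may be crude: the
    [+ 1] in [rho] covers critical damping without a case distinction. *)
Lemma dmode_bound m D l : 0 < m ->
  exists K sigma : R, [/\ 0 <= K,
    forall t, 0 <= t -> `|mode m D l t| <= K * expR (sigma * t) &
    forall t, 0 <= t -> `|dmode m D l t| <= K * expR (sigma * t)].
Proof.
move=> m0; set a := D / (2 * m); set k := a ^+ 2 - l / m.
pose rho := Num.sqrt k + 1.
have r0 := sqrtr_ge0 k.
have [||K K0 hK] := @sinhc_bound k rho; [rewrite /rho; lra|move=> _;
  rewrite /rho; lra|].
exists (m^-1 * (1 + (1 + `|a|) * K)), (rho - a).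
have mi : 0 <= m^-1 by rewrite invr_ge0 ltW.
have an := normr_ge0 a.
split => [|t t0|t t0].
- by rewrite mulr_ge0//; nra.
- rewrite /mode -/a -/k normrM ger0_norm// -mulrA ler_wpM2l//.
  rewrite normrM ger0_norm ?expR_ge0//.
  apply: (le_trans (ler_wpM2l (expR_ge0 _) (hK t t0))).
  rewrite mulrCA -expRD (_ : - a * t + rho * t = (rho - a) * t); last ring.
  by rewrite ler_wpM2r ?expR_ge0//; nra.
- rewrite /dmode -/a -/k normrM ger0_norm// -mulrA ler_wpM2l//.
  rewrite normrM ger0_norm ?expR_ge0//.
  rewrite (_ : (rho - a) * t = - a * t + rho * t); last ring.
  rewrite expRD mulrCA ler_wpM2l ?expR_ge0//.
  apply: le_trans (ler_normD _ _) _.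
  have := coshc_bound k t0.
  have : expR (Num.sqrt k * t) <= expR (rho * t) by apply: ler_expRM => //;
    rewrite /rho; lra.
  have := hK t t0; rewrite normrM normrN.
  have := expR_ge0 (rho * t); have := normr_ge0 (sinhc k t).
  set e := expR (rho * t); set S := `|sinhc k t|; set Ch := `|coshc k t|.
  move=> S0 e0 hS he hC.
  have : `|a| * S <= `|a| * (K * e) by rewrite ler_wpM2l.
  have : 0 <= K * e by rewrite mulr_ge0.
  lra.
Qed.

End Modes.

(** * Laplace transforms of solutions of second-order linear equations *)

Section ModeTransform.
Variable R : realType.
Notation mu := (@lebesgue_measure R).
Implicit Types (m D l x y t K sigma : R).

Lemma continuous_mul (f g : R -> R) :
  continuous f -> continuous g -> continuous (fun t => f t * g t).
Proof. by move=> cf cg t; apply: continuousM; [exact: cf|exact: cg]. Qed.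

(* The real and imaginary parts of
   [- exp (- s t) ((m s + D) f t + m f' t) / (m s^2 + D s + l)], [s = x + i y],
   which is an antiderivative of [exp (- s t) f t] when
   [m f'' + D f' + l f = 0]. *)
Lemma laplace_ode m D l (f g : R -> R) K sigma : m != 0 ->
  (forall t, is_derive t 1 f (g t)) ->
  (forall t, is_derive t 1 g (- (D * g t + l * f t) / m)) ->
  f 0 = 0 -> g 0 = m^-1 -> 0 <= K ->
  (forall t, 0 <= t -> `|f t| <= K * expR (sigma * t)) ->
  (forall t, 0 <= t -> `|g t| <= K * expR (sigma * t)) ->
  is_inverse_laplace (fun s => (m%:C * s ^+ 2 + D%:C * s + l%:C)^-1) f.
Proof.
move=> m0 df dg f0 g0 K0 fK gK.
have cf := continuous_is_derive df; have cg := continuous_is_derive dg.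
split; first exact: continuous_subspaceT.
exists sigma => -[x y] /= sx.
pose ex t := expR (- (x * t)).
pose c t := ex t * cos (y * t) * f t; pose s t := ex t * sin (y * t) * f t.
pose e := x - sigma; have e0 : 0 < e by rewrite subr_gt0.
have exE t : ex t = expR (- x * t) by rewrite /ex mulNr.
have dex t : is_derive t 1 ex (- x * ex t).
  rewrite exE (_ : ex = fun t => expR (- x * t)); last exact/funext.
  exact: is_derive_expRM.
have cex := continuous_is_derive dex.
have dcos t := is_derive_cosM y t; have dsin t := is_derive_sinM y t.
have ccos := continuous_is_derive dcos; have csin := continuous_is_derive dsin.
have fe t (h : R -> R) C : 0 <= t -> 0 <= C ->
  `|h t| <= C * (K * expR (sigma * t)) ->
    `|ex t * h t| <= C * K * expR (- e * t).
  move=> t0 C0 ht; rewrite normrM ger0_norm ?expR_ge0// exE.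
  apply: le_trans (ler_wpM2l (expR_ge0 _) ht) _.
  rewrite (_ : - e * t = - x * t + sigma * t) ?expRD; last by rewrite /e; ring.
  by rewrite le_eqVlt; apply/orP; left; apply/eqP; ring.
have i0 : mu.-integrable `[0%R, +oo[ (EFin \o (fun t => ex t * f t)).
  have eN : - e < 0 by rewrite oppr_lt0.
  apply: le_integrable (integrableZl _ K (integrable_expRM eN)) => //.
    apply/measurable_EFinP; apply: measurable_funTS.
    apply: continuous_measurable_fun.
    exact: continuous_mul.
  move=> t; rewrite /= in_itv/= andbT => t0; rewrite lee_fin.
  have := fe t f 1 t0 ler01; rewrite !mul1r => /(_ (fK t t0)) h.
  by apply: le_trans h _; rewrite ler_norm.
split=> //.
have [ic is_] := @integrable_laplace R f (x +i* y) i0.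
rewrite /= -/(c _) -/(s _) in ic is_.
have cc : continuous c by do 2 apply: continuous_mul => //.
have cs : continuous s by do 2 apply: continuous_mul => //.
have cosn t : `|cos (y * t)| <= 1 by rewrite ler_norml cos_geN1 cos_le1.
have sinn t : `|sin (y * t)| <= 1 by rewrite ler_norml sin_geN1 sin_le1.
have bnd t (h1 h2 : R -> R) (a b c1 c2 : R) : 0 <= t -> `|h1 t| <= 1 ->
  `|h2 t| <= 1 ->
  `|h1 t * (a * f t + b * g t) + h2 t * (c1 * f t + c2 * g t)| <=
     (`|a| + `|b| + `|c1| + `|c2|) * (K * expR (sigma * t)).
  move=> t0 b1 b2.
  have hf := fK t t0; have hg := gK t t0.
  apply: le_trans (ler_normD _ _) _.
  rewrite !normrM.
  have k (u v p q : R) : `|u * f t + v * g t| <= (`|u| + `|v|) * (K * expR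
    (sigma * t)).
    apply: le_trans (ler_normD _ _) _; rewrite !normrM mulrDl.
    by rewrite lerD// ler_wpM2l.
  have := ler_pM (normr_ge0 _) (normr_ge0 _) b1 (k a b 0 0).
  have := ler_pM (normr_ge0 _) (normr_ge0 _) b2 (k c1 c2 0 0).
  by rewrite !mul1r; lra.
pose p1 := m * (x ^+ 2 - y ^+ 2) + D * x + l; pose p2 := 2 * m * x * y + D * y.
(* The real and imaginary parts of exp (- s t) ((m s + D) f + m f') both have this shape. They
   vanish at infinity, and at 0 only b f'(0) = b / m is left. *)
have key (A B a b c1 c2 : R) :
    (forall t, is_derive t 1
       (fun t => ex t * (cos (y * t) * (a * f t + b * g t) +
                         sin (y * t) * (c1 * f t + c2 * g t)))
       (A * c t + B * s t)) ->
    A * \int[mu]_(t in `[0%R, +oo[) c t + B * \int[mu]_(t in `[0%R, +oo[) s t =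
    - (b / m).
  move=> dF.
  pose C := `|A| + `|B| + (`|a| + `|b| + `|c1| + `|c2|).
  have C0 : 0 <= C by rewrite !addr_ge0.
  have ie t : 0 <= K * expR (- e * t) by rewrite mulr_ge0// expR_ge0.
  have [|||_] := Rintegral_FTC2y (K := C * K) e0 _ dF.
  - move=> t; apply: cvgD; apply: cvgM; (try exact: cvg_cst);
      [exact: cc|exact: cs].
  - move=> t t0.
    rewrite (_ : A * c t + B * s t =
      ex t * ((A * cos (y * t) + B * sin (y * t)) * f t)); last first.
      by rewrite /c /s; ring.
    apply: (fe _ (fun t => (A * cos (y * t) + B * sin (y * t)) * f t)) => //.
    rewrite normrM ler_pM//; last exact: fK.
    apply: le_trans (ler_normD _ _) _; rewrite !normrM.
    have := ler_wpM2l (normr_ge0 A) (cosn t).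
    have := ler_wpM2l (normr_ge0 B) (sinn t).
    rewrite /C; have := normr_ge0 a; have := normr_ge0 b; have := normr_ge0 c1.
    have := normr_ge0 c2; lra.
  - move=> t t0; apply: (fe _ (fun t => cos (y * t) * (a * f t + b * g t) +
                         sin (y * t) * (c1 * f t + c2 * g t))) => //.
    apply: le_trans (bnd t (fun t => cos (y * t)) (fun t => sin (y * t)) a b c1
      c2 t0 (cosn t) (sinn t)) _.
    apply: ler_wpM2r; first by rewrite mulr_ge0// expR_ge0.
    by rewrite /C; have := normr_ge0 A; have := normr_ge0 B; lra.
  have iAc : mu.-integrable `[0%R, +oo[ (EFin \o (fun t => A * c t)).
    by apply: eq_integrable (integrableZl _ A ic).
  have iBs : mu.-integrable `[0%R, +oo[ (EFin \o (fun t => B * s t)).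
    by apply: eq_integrable (integrableZl _ B is_).
  rewrite RintegralD// !RintegralZl// => ->.
  by rewrite /ex !mulr0 oppr0 expR0 cos0 sin0 f0 g0; field.
(* [key1] and [key2] are the real and imaginary parts of (m s^2 + D s + l) times the transform of f
   being 1. *)
have key1 : p1 * \int[mu]_(t in `[0%R, +oo[) c t +
            p2 * \int[mu]_(t in `[0%R, +oo[) s t = 1.
  have := key (- p1) (- p2) (m * x + D) m (m * y) 0.
  rewrite divff// => h; suff: - p1 * \int[mu]_(t in `[0%R, +oo[) c t +
     - p2 * \int[mu]_(t in `[0%R, +oo[) s t = - 1 by lra.
  apply: h => t.
  have := is_derive_mul (dex t) (is_derive_add
     (is_derive_mul (dcos t) (is_derive_add (is_derive_cmul (m * x + D) (df t))
       (is_derive_cmul m (dg t))))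
     (is_derive_mul (dsin t) (is_derive_add (is_derive_cmul (m * y) (df t))
       (is_derive_cmul 0 (dg t))))).
  by move=> h'; apply: (is_derive_eq h'); rewrite /c /s /p1 /p2; field.
have key2 : p2 * \int[mu]_(t in `[0%R, +oo[) c t -
            p1 * \int[mu]_(t in `[0%R, +oo[) s t = 0.
  have := key (- p2) p1 (m * y) 0 (- (m * x + D)) (- m).
  rewrite mul0r oppr0 => h; suff: - p2 * \int[mu]_(t in `[0%R, +oo[) c t +
     p1 * \int[mu]_(t in `[0%R, +oo[) s t = 0 by lra.
  apply: h => t.
  have := is_derive_mul (dex t) (is_derive_add
     (is_derive_mul (dcos t) (is_derive_add (is_derive_cmul (m * y) (df t))
       (is_derive_cmul 0 (dg t))))
     (is_derive_mul (dsin t) (is_derive_add (is_derive_cmul (- (m * x + D)) (df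
       t)) (is_derive_cmul (- m) (dg t))))).
  by move=> h'; apply: (is_derive_eq h'); rewrite /c /s /p1 /p2; field.
set p := _ + l%:C.
have pE : p = p1 +i* p2.
  rewrite /p expr2; apply/eqP; rewrite eq_complex /= /p1 /p2.
  by apply/andP; split; apply/eqP; ring.
have pL : p * laplace f (x +i* y) = 1.
  rewrite pE /laplace /= -/(c _) -/(s _); apply/eqP; rewrite eq_complex/=.
  by apply/andP; split; apply/eqP; [apply: etrans key1|apply: etrans key2];
    ring.
(* No root needs to be located: a product equal to 1 has no zero factor. *)
have p0 : p != 0.
  by apply/eqP => p0; move: pL; rewrite p0 mul0r => /esym/eqP; rewrite oner_eq0.
by apply: (mulfI p0); rewrite pL divff.
Qed.

Lemma mode_inverse_laplace m D l : 0 < m ->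
  is_inverse_laplace (fun s => (m%:C * s ^+ 2 + D%:C * s + l%:C)^-1) (mode m D
    l).
Proof.
move=> m0; have [K [sigma [K0 hf hg]]] := @dmode_bound R m D l m0.
have m1 : m != 0 by rewrite gt_eqF.
apply: (laplace_ode m1 (is_derive_mode m D l) _ _ _ K0 hf hg).
- by move=> t; exact: is_derive_dmode.
- by rewrite /mode sinhc0 !mulr0.
- by rewrite /dmode sinhc0 coshc0 !mulr0 expR0 addr0 !mulr1.
Qed.

End ModeTransform.

(** * Modal decomposition of the closed loop *)

Section Network.
Variable R : realType.
Local Notation RC := (real_complex R).

Lemma complex_mxE m n (M : 'M[R]_(m, n)) : complex_mx M = map_mx RC M.
Proof. by apply/matrixP => i j; rewrite !mxE. Qed.

Lemma complex_mxM m n p (M : 'M[R]_(m, n)) (N : 'M[R]_(n, p)) :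
  complex_mx (M *m N) = complex_mx M *m complex_mx N.
Proof. by rewrite !complex_mxE map_mxM. Qed.

Lemma complex_mx1 n : complex_mx (1%:M : 'M[R]_n) = 1%:M.
Proof. by rewrite complex_mxE map_mx1. Qed.

Lemma invmx_eq (K : comUnitRingType) n (M N : 'M[K]_n) : M *m N = 1%:M ->
  invmx M = N.
Proof.
move=> MN; have [uM _] := mulmx1_unit MN.
by rewrite -[LHS]mulmx1 -MN mulKmx.
Qed.

Lemma scaleV_mxK n (r : 'I_n -> R) : (forall i, 0 < r i) ->
  scaleV_mx r *m scale_mx r = 1%:M.
Proof.
move=> hr; rewrite /scaleV_mx /scale_mx mulmx_diag; apply/matrixP => i j.
by rewrite !mxE mulVf// gt_eqF// sqrtr_gt0.
Qed.

Lemma scale_mxK n (r : 'I_n -> R) : (forall i, 0 < r i) ->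
  scale_mx r *m scaleV_mx r = 1%:M.
Proof. by move=> hr; exact/mulmx1C/scaleV_mxK. Qed.

Lemma scaleV_mx_sqr n (r : 'I_n -> R) : (forall i, 0 < r i) ->
  scaleV_mx r *m scaleV_mx r = diag_mx (\row_i (r i)^-1).
Proof.
move=> hr; rewrite /scaleV_mx mulmx_diag; congr diag_mx; apply/rowP => i.
by rewrite !mxE -invfM -expr2 sqr_sqrtr// ltW.
Qed.

Lemma laplacian_const n (w : 'M[R]_n) : laplacian w *m const_mx 1 = 0 :> 'cV_n.
Proof.
apply/colP => i; rewrite !mxE (bigD1 i)//= !mxE eqxx mulr1.
rewrite -[X in _ + X]opprK -sumrN.
rewrite [X in _ - X](eq_bigr (fun k => w i k)) ?subrr// => k ki.
by rewrite !mxE eq_sym (negbTE ki) mulr1 opprK.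
Qed.

Section Frequency.
Variables (n : nat) (LB : 'M[R]_n) (r : 'I_n -> R) (go co : R[i] -> R[i]).
Variables (lam : 'I_n -> R) (V : 'M[R]_n) (u0 : 'cV[R]_n).
Hypothesis hr : forall i, 0 < r i.
Hypothesis hV : ordered_eigenbasis (scaled_laplacian LB r) lam V.

Definition mode_coef i k : R :=
  (scaleV_mx r *m V) i k * (V^T *m scaleV_mx r *m u0) k 0.

Lemma mode_coefE i k :
  (scaleV_mx r *m col k V *m (col k V)^T *m scaleV_mx r *m u0) i 0 =
    mode_coef i k.
Proof.
rewrite -!mulmxA mulmxA mxE big_ord1 /mode_coef -mulmxA; congr (_ * _).
  by rewrite !mxE; apply: eq_bigr => j _; rewrite !mxE.
by rewrite [LHS]mxE [RHS]mxE; apply: eq_bigr => j _; rewrite !mxE.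
Qed.

Lemma eigenbasisE : scaled_laplacian LB r *m V = V *m diag_mx (\row_k lam k).
Proof.
have [_ _ hL] := hV; apply/matrixP => i k.
have /colP/(_ i) := hL k.
rewrite !colE mulmxA -!colE mul_mx_diag !mxE => ->.
by rewrite mulrC.
Qed.

(** By proportionality [r i] cancels in the product of the generator and inverter matrices, which is
    therefore scalar. The inverse of diag r is kept as a square so that the scaled Laplacian can be
    recognised. *)
Lemma closed_loop_mxE s : 1 - go s * co s != 0 ->
  closed_loop_mx r go co s =
    (go s / (1 - go s * co s)) *: complex_mx (scaleV_mx r *m scaleV_mx r).
Proof.
move=> c0; rewrite /closed_loop_mx scaleV_mx_sqr//.
have -> : 1%:M - gen_mx r go s *m inv_mx r co s = (1 - go s * co s)%:M.
  rewrite /gen_mx /inv_mx mulmx_diag; apply/matrixP => i j; rewrite !mxE.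
  case: eqP => _; rewrite ?mulr1n ?mulr0n ?subr0//; congr (1 - _).
  by field; rewrite fmorph_eq0 gt_eqF.
rewrite invmx_scalar mul_scalar_mx; apply/matrixP => i j; rewrite !mxE.
case: eqP => _; rewrite ?mulr1n ?mulr0n ?rmorph0 ?mulr0// fmorphV/=.
by field; rewrite fmorph_eq0 gt_eqF.
Qed.

(** [P] = R^(-1/2) V, of inverse [Q] = V^T R^(1/2), diagonalises R^(-1) LB although that matrix is
    not symmetric, hence also the matrix to be inverted. The closed loop then acts on u0 through Q
    R^(-1) = V^T R^(-1/2). *)
Lemma omega_hatE s i : s != 0 -> 1 - go s * co s != 0 ->
  (forall k, 1 + go s * ((lam k)%:C / s - co s) != 0) ->
  omega_hat LB r go co u0 s i 0 =
    \sum_k (mode_coef i k)%:C * (z_hat go co (lam k) s / s).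
Proof.
move=> s0 c0 hk.
set h := go s / (1 - go s * co s).
(* This factorisation makes the diagonal entries [Dl] nonzero and later turns [h / Dl] into
   [z_hat]. *)
have h1 k : 1 + go s * ((lam k)%:C / s - co s) =
    (1 - go s * co s) * (1 + h * ((lam k)%:C / s)) by rewrite /h; field;
      rewrite s0.
pose Dl : 'rV[R[i]]_n := \row_k (1 + h * ((lam k)%:C / s)).
have Dl0 k : Dl 0 k != 0.
  by rewrite mxE; have := hk k; rewrite h1 mulf_eq0 negb_or => /andP[].
pose Di : 'rV[R[i]]_n := \row_k (Dl 0 k)^-1.
pose P := scaleV_mx r *m V; pose Q := V^T *m scale_mx r.
have [_ VV _] := hV; have VV' := mulmx1C VV.
have PQ : P *m Q = 1%:M.
  by rewrite /P /Q mulmxA -(mulmxA _ V) VV' mulmx1 scaleV_mxK.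
have LP : scaleV_mx r *m scaleV_mx r *m LB *m P = P *m diag_mx (\row_k lam k).
  rewrite /P -[RHS]mulmxA -eigenbasisE /scaled_laplacian !mulmxA.
  by rewrite -!mulmxA.
have DD : diag_mx Dl *m diag_mx Di = 1%:M.
  rewrite mulmx_diag; apply/matrixP => a b; rewrite mxE [RHS]mxE.
  by congr (_ *+ _); rewrite mxE [Di _ _]mxE divff.
rewrite /omega_hat closed_loop_mxE// -/h.
set H := complex_mx (_ *m _).
have AP : (1%:M + h *: H *m (s^-1 *: complex_mx LB)) *m complex_mx P =
          complex_mx P *m diag_mx Dl.
  rewrite mulmxDl mul1mx -scalemxAl -scalemxAr scalerA -scalemxAl -!complex_mxM
    LP.
  rewrite complex_mxM (_ : diag_mx Dl =
    1%:M + (h / s) *: complex_mx (diag_mx (\row_k lam k))).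
    by rewrite mulmxDr mulmx1 -scalemxAr.
  apply/matrixP => a b; rewrite !mxE; case: eqP => _; rewrite ?mulr1n ?mulr0n;
    last first.
    by rewrite raddf0 mulr0 addr0.
  by rewrite mulrA mulrAC.
rewrite (@invmx_eq _ _ _ (complex_mx P *m diag_mx Di *m complex_mx Q));
  last first.
  by rewrite !mulmxA AP -(mulmxA _ (diag_mx Dl)) DD mulmx1 -complex_mxM PQ
    complex_mx1.
have QH : complex_mx Q *m (h *: H) *m (s^-1 *: complex_mx u0) =
    (h / s) *: complex_mx (V^T *m scaleV_mx r *m u0).
  rewrite -scalemxAr -scalemxAr -scalemxAl scalerA mulrC -!complex_mxM;
    congr (_ *: complex_mx _).
  rewrite /Q -!mulmxA; congr (_ *m _).
  by rewrite !mulmxA scale_mxK// mul1mx.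
rewrite -!mulmxA (mulmxA (complex_mx Q)) QH mulmxA.
rewrite mxE; apply: eq_bigr => k _.
have -> : (complex_mx P *m diag_mx Di) i k = (P i k)%:C / Dl 0 k.
  by rewrite mul_mx_diag !mxE.
have -> : ((h / s) *: complex_mx (V^T *m scaleV_mx r *m u0)) k 0 =
    h / s * ((V^T *m scaleV_mx r *m u0) k 0)%:C by rewrite !mxE.
have := Dl0 k; rewrite /z_hat h1 [Dl _ _]mxE /mode_coef -/P rmorphM/= /h => hk0.
field; rewrite s0 c0/=; move: (hk k);
  rewrite h1 mulf_eq0 negb_or => /andP[_] hk1.
rewrite (_ : _ + _ = (1 - go s * co s) * s * (1 + h * ((lam k)%:C / s))).
  by rewrite !mulf_neq0.
by rewrite /h; field; rewrite s0.
Qed.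

End Frequency.

(** * Cancellation of the turbine dynamics by the controller *)

Section Controller.
Variables (m d tau dt db : R).
Hypotheses (hm : 0 < m) (hd : 0 < d) (htau : 0 < tau) (hdt : 0 < dt) (hdb : 0 <
  db).
Let go := generator_tf m d tau dt.
Let co := fs_tf tau dt db.
Let D := d + db + dt.
Implicit Type s : R[i].

Lemma Re_gt0_neq0 s : 0 < complex.Re s -> s != 0.
Proof. by case: s => x y /= x0; rewrite eq_complex/= negb_and gt_eqF. Qed.

Lemma Re_inv_gt0 s : 0 < complex.Re s -> 0 < complex.Re s^-1.
Proof.
case: s => x y /= x0; rewrite divr_gt0// ltr_pwDl// ?sqr_ge0// exprn_gt0//.
Qed.

Lemma Re_scale (a : R) s : complex.Re (a%:C * s) = a * complex.Re s.
Proof. by case: s => x y /=; rewrite mul0r subr0. Qed.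

Lemma ReD s1 s2 : complex.Re (s1 + s2) = complex.Re s1 + complex.Re s2.
Proof. by case: s1 s2 => [x y] [x' y']. Qed.

(** With N = tau s + 1, the generator is the inverse of W = m s + d + dt / N, whose turbine term dt
    / N is the one in the controller. All denominators have positive real part, hence do not
    vanish. *)
Lemma generator_tfE s : 0 < complex.Re s ->
  [/\ go s != 0, 1 - go s * co s != 0 &
    forall l : R, 1 + go s * (l%:C / s - co s) =
      go s * (m%:C * s + D%:C + l%:C / s)].
Proof.
move=> s0; have sn0 := Re_gt0_neq0 s0.
set N := tau%:C * s + 1.
have N0 : 0 < complex.Re N by rewrite ReD Re_scale addr_gt0// mulr_gt0.
have Nn0 := Re_gt0_neq0 N0.
set W := m%:C * s + d%:C + dt%:C / N.
have Wn0 : W != 0.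
  apply: Re_gt0_neq0; rewrite !ReD !Re_scale !addr_gt0 ?mulr_gt0//.
  exact: Re_inv_gt0.
have goE : go s = W^-1.
  rewrite /go /generator_tf -/N (_ : _ + (d + dt)%:C = N * W).
    by field; rewrite Nn0 Wn0.
  rewrite /W !rmorphD !rmorphM/= (_ : N * (m%:C * s + d%:C + dt%:C / N) =
    N * (m%:C * s + d%:C) + dt%:C).
    by rewrite /N; ring.
  by field.
have WE : W = m%:C * s + D%:C + co s.
  by rewrite /W /co /fs_tf -/N /D !rmorphD/=; ring.
split.
- by rewrite goE invr_eq0.
- rewrite goE (_ : _ - _ = W^-1 * (m%:C * s + D%:C)).
    rewrite mulf_neq0 ?invr_eq0//; apply: Re_gt0_neq0.
    by rewrite ReD Re_scale addr_gt0 ?mulr_gt0 ?addr_gt0.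
  have -> : co s = W - (m%:C * s + D%:C) by rewrite WE; ring.
  by field.
- move=> l; rewrite goE.
  have -> : co s = W - (m%:C * s + D%:C) by rewrite WE; ring.
  by field; rewrite Wn0 sn0.
Qed.

Lemma z_hat_step (l : R) s : 0 < complex.Re s ->
  z_hat go co l s / s = (m%:C * s ^+ 2 + D%:C * s + l%:C)^-1.
Proof.
move=> s0; have sn0 := Re_gt0_neq0 s0; have [g0 _ E] := generator_tfE s0.
rewrite /z_hat E invfM mulrA divff// mul1r -invfM; congr (_^-1).
by field.
Qed.

Lemma z_step_mode (l : R) t : 0 <= t -> z_step go co l t = mode m D l t.
Proof.
move=> t0; apply: inverse_laplaceE t0.
apply: (@eq_is_inverse_laplace _ _ _ _ 0 _ (mode_inverse_laplace D l hm)) => s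
  s0.
by rewrite z_hat_step.
Qed.

Lemma generator_tf_neq0 (l : R) s : 0 <= l -> 0 < complex.Re s ->
  1 + go s * (l%:C / s - co s) != 0.
Proof.
move=> l0 s0; have [g0 _ ->] := generator_tfE s0; rewrite mulf_neq0//.
apply: Re_gt0_neq0; rewrite !ReD !Re_scale/= ltr_pwDl ?addr_gt0 ?mulr_gt0
  ?addr_gt0//.
by rewrite mulr_ge0// ltW// Re_inv_gt0.
Qed.

(** The sum of modes is exhibited as one inverse transform of the whole coordinate, which avoids any
    linearity of the chosen inverses. *)
Lemma omega_modes n (LB : 'M[R]_n) (r : 'I_n -> R) (lam : 'I_n ->
  R) (V : 'M[R]_n)
    (u0 : 'cV[R]_n) i t :
  (forall i, 0 < r i) -> ordered_eigenbasis (scaled_laplacian LB r) lam V ->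
  (forall k, 0 <= lam k) -> 0 <= t ->
  omega LB r go co u0 t i 0 = \sum_k mode_coef r V u0 i k * mode m D (lam k) t.
Proof.
move=> hr hV hlam t0; rewrite mxE.
have h := is_inverse_laplace_sum (mode_coef r V u0 i)
  (fun k => mode_inverse_laplace D (lam k) hm).
apply: (inverse_laplaceE
  (f := fun t => \sum_k mode_coef r V u0 i k * mode m D (lam k) t) _ t0).
apply: (@eq_is_inverse_laplace _ _ _ _ 0 _ h) => s s0.
have [_ c0 _] := generator_tfE s0.
rewrite (omega_hatE u0 hr hV) ?(Re_gt0_neq0 s0)// => [|k];
  last exact: generator_tf_neq0.
by apply: eq_bigr => k _; rewrite z_hat_step.
Qed.

(** For l = 0 the square root equals D / (2 m), so the two exponents become 0 and - D / m. *)
Lemma mode_zero t : mode m D 0 t = D^-1 * (1 - expR (- (D / m * t))).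
Proof.
have D0 : 0 < D by rewrite /D !addr_gt0.
rewrite /mode mul0r subr0 /sinhc.
have a0 : 0 < D / (2 * m) by rewrite divr_gt0// mulr_gt0.
rewrite exprn_gt0// sqrtr_sqr ger0_norm ?(ltW a0)//.
rewrite mulrA mulrBr -!expRD -mulrDl addNr mul0r expR0.
rewrite (_ : - (D / (2 * m)) * t + - (D / (2 * m)) * t = - (D / m * t)).
  by field; rewrite !gt_eqF.
by field; rewrite gt_eqF.
Qed.

(** The first branch is the case of a nonpositive radicand, where [Num.sqrt] returns 0; one formula
    thus covers both branches. *)
Lemma sync_rateE (l : R) : 0 <= l ->
  sync_rate m d dt db l = D / (2 * m) - Num.sqrt ((D / (2 * m)) ^+ 2 - l / m).
Proof.
move=> l0; have D0 : 0 < D by rewrite /D !addr_gt0.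
have lm0 : 0 <= l * m by rewrite mulr_ge0// ltW.
have kE : (D / (2 * m)) ^+ 2 - l / m = (D ^+ 2 - 4 * l * m) * ((2 * m)^-1) ^+ 2.
  by field; rewrite gt_eqF.
rewrite /sync_rate -/D kE; case: ifP => [h|_].
  rewrite [Num.sqrt _]ler0_sqrtr ?subr0//.
  have : D <= 2 * Num.sqrt (l * m) by rewrite /D; lra.
  move=> h2; rewrite pmulr_lle0 ?exprn_gt0 ?invr_gt0 ?mulr_gt0//.
  have := sqr_sqrtr lm0; have := sqrtr_ge0 (l * m); nra.
rewrite [X in _ = _ - Num.sqrt X]mulrC sqrtrM ?sqr_ge0//
  sqrtr_sqr ger0_norm ?invr_ge0 ?mulr_ge0 ?(ltW hm)//.
by field; rewrite gt_eqF.
Qed.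

Lemma critical_disc (l : R) : 0 <= l ->
  D = 2 * Num.sqrt (l * m) <-> (D / (2 * m)) ^+ 2 - l / m = 0.
Proof.
move=> l0; have D0 : 0 < D by rewrite /D !addr_gt0.
have lm0 : 0 <= l * m by rewrite mulr_ge0// ltW.
have m0 : m != 0 by rewrite gt_eqF.
have kE : (D / (2 * m)) ^+ 2 - l / m =
  (D ^+ 2 - 4 * (l * m)) * ((2 * m)^-1) ^+ 2.
  by field.
rewrite kE; split => [->|/eqP].
  by rewrite exprMn sqr_sqrtr//; ring.
rewrite mulf_eq0 expf_eq0/= invr_eq0 mulf_eq0 (negbTE m0) pnatr_eq0/= !orbF.
rewrite subr_eq0 => /eqP DE.
rewrite -[LHS](ger0_norm (ltW D0)) -sqrtr_sqr DE sqrtrM// (_ : 4 =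
  2 ^+ 2) ?sqrtr_sqr ?ger0_norm//.
by rewrite -natrX.
Qed.

End Controller.
End Network.

(** * Decay rates *)

Section Decay.
Variable R : realType.
Implicit Types (a b c : R) (f g : R -> R).

(** Allowing [K = 0] makes zero and empty sums unexceptional; the strict inequalities of the final
    notions are restored by adding 1 to the constant. *)
Definition exp_bounded a f :=
  exists2 K : R, 0 <= K & forall t, 0 <= t -> `|f t| <= K * expR (- a * t).

Lemma exp_boundedW a b f : a <= b -> exp_bounded b f -> exp_bounded a f.
Proof.
move=> ab [K K0 h]; exists K => // t t0; apply: le_trans (h t t0) _.
by rewrite ler_wpM2l// ler_expRM// lerN2.
Qed.

Lemma eq_exp_bounded a f g : (forall t, 0 <= t -> f t = g t) ->
  exp_bounded a f -> exp_bounded a g.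
Proof. by move=> fg [K K0 h]; exists K => // t t0; rewrite -fg ?h. Qed.

Lemma exp_boundedD a f g : exp_bounded a f -> exp_bounded a g ->
  exp_bounded a (fun t => f t + g t).
Proof.
move=> [K K0 h] [L L0 k]; exists (K + L) => [|t t0]; first exact: addr_ge0.
by rewrite mulrDl (le_trans (ler_normD _ _))// lerD ?h ?k.
Qed.

Lemma exp_boundedM a c f : exp_bounded a f -> exp_bounded a (fun t => c * f t).
Proof.
move=> [K K0 h]; exists (`|c| * K) => [|t t0]; first exact: mulr_ge0.
by rewrite normrM -mulrA ler_wpM2l ?h.
Qed.

Lemma exp_bounded_sum a (I : Type) (e : seq I) (P : pred I) (F : I -> R -> R) :
  (forall k, P k -> exp_bounded a (F k)) ->
  exp_bounded a (fun t => \sum_(k <- e | P k) F k t).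
Proof.
move=> h; elim: e => [|k e IH].
  by exists 0 => // t _; rewrite big_nil normr0 mul0r.
apply: (@eq_exp_bounded _ (fun t => (if P k then F k t else 0) +
    \sum_(j <- e | P j) F j t)).
  by move=> t _; rewrite big_cons; case: ifP; rewrite ?add0r.
apply: exp_boundedD IH; case: (P k) (h k) => [hk|_]; first exact: hk.
by exists 0 => // t _; rewrite normr0 mul0r.
Qed.

Lemma norm2_le_sum n (v : 'cV[R]_n) : norm2 v <= \sum_i `|v i 0|.
Proof.
have s0 : 0 <= \sum_i `|v i 0| by apply: sumr_ge0.
rewrite /norm2 -[leRHS](ger0_norm s0) -sqrtr_sqr ler_sqrt ?sqr_ge0//.
rewrite expr2 mulr_suml; apply: ler_sum => i _.
rewrite -[v i 0 ^+ 2]ger0_norm ?sqr_ge0// normrX expr2 ler_wpM2l//.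
by rewrite (bigD1 i)//= lerDl sumr_ge0.
Qed.

Lemma decays_exponentially_coord n (x : R -> 'cV[R]_n) a :
  (forall i, exp_bounded a (fun t => x t i 0)) -> decays_exponentially x a.
Proof.
move=> h.
have [K K0 hK] : exp_bounded a (fun t => \sum_i `|x t i 0|).
  apply: exp_bounded_sum => i _; have [K K0 hK] := h i.
  by exists K => // t t0; rewrite normr_id hK.
exists (K + 1) => [|t t0]; first by rewrite ltr_wpDl.
apply: le_trans (norm2_le_sum _) _; apply: le_trans (ler_norm _) _.
apply: le_trans (hK t t0) _.
by rewrite mulNr ler_wpM2r ?expR_ge0// lerDl.
Qed.

Lemma synchronizes_exponentially_coord n (x : R -> 'cV[R]_n)
    (xinf : 'cV[R]_n) a :
  (forall i, exp_bounded a (fun t => x t i 0 - xinf i 0)) ->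
  synchronizes_exponentially x xinf a.
Proof.
move=> h; have [i|C C0 hC] :=
  @decays_exponentially_coord n (fun t => x t - xinf) a.
  by apply: eq_exp_bounded (h i) => t _; rewrite !mxE.
exists (C + 1) => [|t t0]; first exact: addr_gt0.
apply: le_lt_trans (hC t t0) _.
by rewrite ltr_pM2r ?expR_gt0// ltrDl.
Qed.

End Decay.

(* There are n.+2 >= 2 buses, numbered from 0: lam 0, lam 1 are the paper's
   lambda_1, lambda_2.  When d + db + dt = 2 sqrt (lambda_2 m) the mode
   z_(u,2)(t) is t e^(-alpha t) / m with alpha = sync_rate, so that decay at
   the rate alpha itself fails for generic u0; the two estimates at rate alpha
   are claimed off that value, and at that value for every smaller rate. *)
Theorem proposition1 (R : realType) (n : nat)
    (m d tau dt db : R)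
    (hm : 0 < m) (hd : 0 < d) (htau : 0 < tau) (hdt : 0 < dt) (hdb : 0 < db)
    (LB : 'M[R]_n.+2) (hLB : connected_network_laplacian LB)
    (r : 'I_n.+2 -> R) (hr : forall i, 0 < r i)
    (lam : 'I_n.+2 -> R) (V : 'M[R]_n.+2)
    (hV : ordered_eigenbasis (scaled_laplacian LB r) lam V)
    (hv1 : col ord0 V =
       (Num.sqrt (\sum_i r i))^-1 *: (scale_mx r *m const_mx 1))
    (u0 : 'cV[R]_n.+2) :
  let go := generator_tf m d tau dt in
  let co := fs_tf tau dt db in
  let lambda2 := lam (lift ord0 ord0) in
  let alpha := sync_rate m d dt db lambda2 in
  let critical := d + db + dt = 2 * Num.sqrt (lambda2 * m) in
  let w := omega LB r go co u0 in
  let wbar := omega_coi r go co lam u0 in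
  let wtilde := omega_osc r go co lam V u0 in
  let wbar_inf := (\sum_i u0 i 0) / ((d + db + dt) * \sum_i r i) in
  [/\ forall t, 0 <= t -> w t = wbar t *: const_mx 1 + wtilde t,
      (~ critical ->
         synchronizes_exponentially w (wbar_inf *: const_mx 1) alpha) /\
      (critical -> forall a, a < alpha ->
         synchronizes_exponentially w (wbar_inf *: const_mx 1) a),
      [/\ forall t, 0 <= t ->
            wbar t = wbar_inf * (1 - expR (- ((d + db + dt) / m * t))),
          wbar t @[t --> +oo] --> wbar_inf,
          exists2 C : R, 0 < C & forall t, 0 <= t ->
            `|wbar t - wbar_inf| <= C * expR (- ((d + db + dt) / m * t))
        & alpha < (d + db + dt) / m]
    & (~ critical -> decays_exponentially wtilde alpha) /\
      (critical -> forall a, a < alpha -> decays_exponentially wtilde a)].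
Proof.
move=> go co lambda2 alpha critical w wbar wtilde wbar_inf.
pose D := d + db + dt.
have D0 : 0 < D by rewrite !addr_gt0.
have r0 : 0 < \sum_i r i.
  by rewrite (bigD1 ord0)//= ltr_pwDl// sumr_ge0// => i _; rewrite ltW.
set rs := \sum_i r i in r0 hv1 *.
have s0 : 0 < Num.sqrt rs by rewrite sqrtr_gt0.
have [hle VV hL] := hV.
(* R^(-1/2) LB R^(-1/2) sends R^(1/2) 1 to R^(-1/2) LB 1 = 0, and the first column of [V] is nonzero
   because it has norm 1. *)
have lam0 : lam ord0 = 0.
  have : scaled_laplacian LB r *m col ord0 V = 0.
    rewrite hv1 /scaled_laplacian -scalemxAr -!mulmxA (mulmxA (scaleV_mx r)
      (scale_mx r)).
    rewrite scaleV_mxK// mul1mx; case: hLB => ? [_ _ _ ->].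
    by rewrite laplacian_const mulmx0 scaler0.
  rewrite hL => /eqP; rewrite scaler_eq0 => /orP[/eqP//|/eqP v0].
  have /matrixP/(_ ord0 ord0) := VV; rewrite !mxE big1 => [/eqP|j _].
    by rewrite eq_sym oner_eq0.
  by have /colP/(_ j) := v0; rewrite !mxE => ->; rewrite mulr0.
have lam_ge0 k : 0 <= lam k by rewrite -lam0 hle.
have lam2_le k : k != ord0 -> lambda2 <= lam k.
  by move=> k0; apply: hle; rewrite lt0n.
have modeE l t : 0 <= t -> z_step go co l t = mode m D l t.
  exact: z_step_mode.
(* R^(-1/2) v_1 is the constant vector rs^(-1/2), so this coefficient is the same at every bus. *)
have coef0 i : mode_coef r V u0 i ord0 = (\sum_j u0 j 0) / rs.
  have Vj j : V j ord0 = (Num.sqrt rs)^-1 * Num.sqrt (r j).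
    have /colP/(_ j) := hv1; rewrite !mxE (bigD1 j)//= big1 => [|k kj].
      by rewrite !mxE eqxx mulr1n addr0 mulr1.
    by rewrite !mxE eq_sym (negbTE kj) mul0r.
  have rj j : Num.sqrt (r j) != 0 by rewrite gt_eqF// sqrtr_gt0.
  rewrite /mode_coef /scaleV_mx mul_diag_mx mul_mx_diag !mxE Vj.
  rewrite mulrCA mulVf// mulr1.
  rewrite (eq_bigr (fun j => (Num.sqrt rs)^-1 * u0 j 0)) => [|j _]; last first.
    by rewrite !mxE Vj; field; rewrite rj gt_eqF.
  rewrite -mulr_sumr mulrA -invfM -expr2 sqr_sqrtr ?ltW// mulrC.
  by [].
have wbarE t : 0 <= t -> wbar t = wbar_inf * (1 - expR (- (D / m * t))).
  move=> t0; rewrite /wbar /omega_coi lam0 modeE// mode_zero//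
    /wbar_inf -/rs -/D.
  by rewrite invfM; ring.
have wtildeE i t : 0 <= t -> wtilde t i 0 =
    \sum_(k | k != ord0) mode_coef r V u0 i k * mode m D (lam k) t.
  move=> t0; rewrite /wtilde /omega_osc summxE; apply: eq_bigr => k _.
  by rewrite mxE mode_coefE modeE// mulrC.
have wE t : 0 <= t -> w t = wbar t *: const_mx 1 + wtilde t.
  move=> t0; apply/colP => i;
    rewrite [RHS]mxE wtildeE//
    /w (omega_modes hm hd htau hdt hdb u0 i hr hV lam_ge0 t0) (bigD1 ord0)//=.
  by rewrite coef0 !mxE mulr1 /wbar /omega_coi modeE.
have k2E : alpha = D / (2 * m) - Num.sqrt ((D / (2 * m)) ^+ 2 - lambda2 / m).
  by apply: sync_rateE => //; exact: lam_ge0.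
have crit : critical <-> (D / (2 * m)) ^+ 2 - lambda2 / m = 0.
  by apply: critical_disc => //; exact: lam_ge0.
set k2 := _ - lambda2 / m in k2E crit.
have alpha_le : alpha <= D / (2 * m) by rewrite k2E gerBl sqrtr_ge0.
have alpha_lt : alpha < D / m.
  apply: le_lt_trans alpha_le _.
  by rewrite ltr_pM2l// ltf_pV2 ?posrE ?mulr_gt0//; lra.
have wtilde_bnd a i : a <= alpha -> (critical -> a < alpha) ->
    exp_bounded a (fun t => wtilde t i 0).
  move=> aa ca.
  apply: (@eq_exp_bounded _ _ (fun t =>
     \sum_(k | k != ord0) mode_coef r V u0 i k * mode m D (lam k) t)).
    by move=> t t0; rewrite wtildeE.
  apply: exp_bounded_sum => k /lam2_le k0; apply: exp_boundedM.
  have kk : (D / (2 * m)) ^+ 2 - lam k / m <= k2.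
    by rewrite lerD2l lerN2 ler_pM2r// invr_gt0.
  apply: mode_bound => // [|kE].
    apply: le_trans aa _; rewrite k2E lerD2l lerN2.
    (* If [k2 < 0], both radicands are negative and both square roots are 0. *)
    by have [h|h] := leP 0 k2;
      [rewrite ler_sqrt|rewrite !ler0_sqrtr// ltW// (le_lt_trans kk)].
  (* A critically damped mode either shares its radicand with lambda2, which is the critical case,
     or has a larger eigenvalue; then [k2 > 0] makes [alpha] strictly less than [D / (2 * m)] and
     leaves room for the factor t. *)
  move: kk; rewrite kE le_eqVlt => /predU1P[k20|k20].
    by apply: lt_le_trans (ca _) alpha_le; apply/crit.
  by apply: le_lt_trans aa _; rewrite k2E gtrBl sqrtr_gt0.
have wbar_bnd a : a <= D / m -> exp_bounded a (fun t => wbar t - wbar_inf).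
  move=> aD; apply: exp_boundedW aD _.
  exists `|wbar_inf| => // t t0; rewrite wbarE//.
  rewrite (_ : _ - _ = - (wbar_inf * expR (- (D / m) * t))); last first.
    by rewrite mulNr; ring.
  by rewrite normrN normrM [`|expR _|]ger0_norm ?expR_ge0.
(* The COI error decays at rate D / m > alpha, so the oscillations dictate the common rate. *)
have sync a : a <= alpha -> (critical -> a < alpha) ->
    synchronizes_exponentially w (wbar_inf *: const_mx 1) a.
  move=> aa ca; apply: synchronizes_exponentially_coord => i.
  apply: eq_exp_bounded (exp_boundedD (wbar_bnd a _) (wtilde_bnd a i aa ca)).
    by move=> t t0; rewrite wE// !mxE; ring.
  by rewrite (le_trans aa)// ltW.
split => //.
- by split=> [nc|c a aa]; apply: sync => //; exact: ltW.
- split=> //.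
  + have c0 : wbar_inf * (1 - expR (- (D / m) * x)) @[x --> +oo] -->
        wbar_inf * (1 - 0).
      apply: cvgMr; apply: cvgB; first exact: cvg_cst.
      by apply: cvg_expRM0; rewrite oppr_lt0 divr_gt0.
    rewrite subr0 mulr1 in c0; apply: cvg_trans c0; apply: near_eq_cvg;
      near=> t.
    rewrite mulNr wbarE//; near: t; exact: nbhs_pinfty_ge.
  + have [K K0 hK] := wbar_bnd (D / m) (lexx _).
    exists (K + 1) => [|t t0]; first by rewrite ltr_wpDl.
    by apply: le_trans (hK t t0) _; rewrite mulNr ler_wpM2r ?expR_ge0// lerDl.
- by split=> [nc|c a aa]; apply: decays_exponentially_coord => i;
    apply: wtilde_bnd => //; exact: ltW.
Unshelve. all: end_near. Qed.
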